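(* Let $\phi$ be an admissible potential with equilibrium state $\mu_\phi$, and let $C>0$ be a constant for which the Gaussian concentration bound holds for $\mu_\phi$. Then for every $n\ge 1$, every separately $d_\theta$-Lipschitz function $K:\Omega^n\to\mathbb{R}$ and every $u>0$, $$\mu_\phi\Big(x\in\Omega: K(x,Tx,\dots,T^{n-1}x)-\int K(y,Ty,\dots,T^{n-1}y)\,d\mu_\phi(y)\ge u\Big)\le \exp\Big(-\frac{u^2}{4C\sum_{i=0}^{n-1}\mathrm{Lip}_{\theta,i}(K)^2}\Big)$$ and $$\mu_\phi\Big(x\in\Omega: \Big|K(x,Tx,\dots,T^{n-1}x)-\int K(y,Ty,\dots,T^{n-1}y)\,d\mu_\phi(y)\Big|\ge u\Big)\le 2\exp\Big(-\frac{u^2}{4C\sum_{i=0}^{n-1}\mathrm{Lip}_{\theta,i}(K)^2}\Big),$$ where the right-hand sides are read as $0$ if $\sum_{i}\mathrm{Lip}_{\theta,i}(K)^2=0$.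
   Context: $A$ is a finite alphabet, $\mathbb{N}=\{0,1,2,\dots\}$, $\Omega=A^{\mathbb{N}}$ with points $x=x^0x^1x^2\cdots$, and $T:\Omega\to\Omega$ is the shift $(Tx)^k=x^{k+1}$. Fix $\theta\in(0,1)$ and put $d_\theta(x,y)=\theta^{\inf\{k:\,x^k\ne y^k\}}$ (with $d_\theta(x,x)=0$). For $\phi:\Omega\to\mathbb{R}$ write $S_n\phi=\sum_{i=0}^{n-1}\phi\circ T^i$. For $x,y\in\Omega$ let $W(\phi,x,y)=\sup_{n\in\mathbb{N}}\sup_{a\in A^n}|S_n\phi(ax)-S_n\phi(ay)|$, and for $p\in\mathbb{N}$ let $W_p(\phi)=\sup\{W(\phi,x,y): x^i=y^i,\ 0\le i\le p-1\}$. A continuous $\phi$ satisfies Walters' condition if $\sup_{x,y}W(\phi,x,y)<\infty$ and $(W_p(\phi))_{p\in\mathbb{N}}$ is strictly positive and decreases to $0$. Such a $\phi$ has a unique equilibrium state $\mu_\phi$ (the unique shift-invariant probability measure maximizing $\nu\mapsto h(\nu)+\int\phi\,d\nu$, $h$ being the entropy). ''Admissible'' means: $\phi$ is continuous, satisfies Walters' condition, and one of: (1) $W_n(\phi)=O(\theta^n)$; (2) $W_n(\phi)=O(n^{-\alpha})$ for some $\alpha>1$; (3) $W_n(\phi)=O(\eta^{(\log n)^{\alpha}})$ for some $\eta\in(0,1)$, $\alpha>1$; (4) $W_n(\phi)=O(e^{-cn^{\alpha}})$ for some $c>0$, $\alpha\in(0,1)$. A function $K:\Omega^n\to\mathbb{R}$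 is separately $d_\theta$-Lipschitz if for every $i\in\{0,\dots,n-1\}$ there is a constant $\mathrm{Lip}_{\theta,i}(K)$ (taken to be the smallest one) such that $|K(x_0,\dots,x_i,\dots,x_{n-1})-K(x_0,\dots,x_i',\dots,x_{n-1})|\le \mathrm{Lip}_{\theta,i}(K)\,d_\theta(x_i,x_i')$ for all points of $\Omega$. The Gaussian concentration bound with constant $C$: for all $n\ge1$ and all separately $d_\theta$-Lipschitz $K:\Omega^n\to\mathbb{R}$, $\int e^{K(x,\dots,T^{n-1}x)}d\mu_\phi(x)\le \exp\big(\int K(x,\dots,T^{n-1}x)\,d\mu_\phi(x)\big)\exp\big(C\sum_{j=0}^{n-1}\mathrm{Lip}_{\theta,j}(K)^2\big)$. For admissible $\phi$ such a constant $C>0$ exists (main theorem of the paper). *)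

(* Defs.v *)
From HB Require Import structures.
From mathcomp Require Import all_boot all_order all_algebra.
From mathcomp Require Import all_classical all_reals all_analysis.

Set Implicit Arguments.
Unset Strict Implicit.
Unset Printing Implicit Defensive.

Import Order.TTheory GRing.Theory Num.Theory.
Import numFieldNormedType.Exports.

Local Open Scope classical_set_scope.
Local Open Scope ring_scope.

(* Nonempty finite alphabets: measurable types are pointed in the library,
   so the alphabet carries a distinguished letter. That letter plays no role:
   nothing below depends on it, and an empty alphabet would leave no
   probability measure on the sequence space. *)
#[short(type="finPointedType")]
HB.structure Definition FinPointed := {A of Finite A & Pointed A}.

Definition Omega (A : finPointedType) : Type :=
  prod_topology (fun _ : nat => discrete_topology A).

HB.instance Definition _ (A : finPointedType) := Pointed.on (Omega A).
HB.instance Definition _ (A : finPointedType) := Nbhs.on (Omega A).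
HB.instance Definition _ (A : finPointedType) := Topological.on (Omega A).

HB.instance Definition _ (A : finPointedType) :=
  Measurable.copy (Omega A) (g_sigma_algebraType (@open (Omega A))).

Section FullShift.
Context {R : realType} {A : finPointedType}.
Implicit Types (x y : Omega A) (phi : Omega A -> R).
Implicit Types (theta C u : R) (nu mu : probability (Omega A) R).

Definition full_shift x : Omega A := fun k => x k.+1.

Definition dtheta theta x y : R :=
  match pselect (exists k, x k != y k) with
  | left neq_xy => theta ^+ ex_minn neq_xy
  | right _ => 0
  end.

Definition birkhoff phi (n : nat) x : R := \sum_(i < n) phi (iter i full_shift x).

(* The point a x; [nth] returns its default x_(k - n) as soon as n <= k. *)
Definition prepend_word (n : nat) (a : n.-tuple A) x : Omega A :=
  fun k => nth (x (k - n)%N) a k.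

Definition Wpair phi x y : \bar R :=
  ereal_sup (range (fun n : nat =>
    ereal_sup (range (fun a : n.-tuple A =>
      `|birkhoff phi n (prepend_word a x) - birkhoff phi n (prepend_word a y)|%:E)))).

Definition Wvar phi (p : nat) : \bar R :=
  ereal_sup [set Wpair phi xy.1 xy.2 | xy in
    [set xy : Omega A * Omega A | forall i, (i < p)%N -> xy.1 i = xy.2 i]].

Definition walters_condition phi : Prop :=
  [/\ (ereal_sup (range (fun xy : Omega A * Omega A => Wpair phi xy.1 xy.2))
         < +oo)%E,
      (forall p, (0 < Wvar phi p)%E),
      {homo Wvar phi : p q / (p <= q)%N >-> (q <= p)%E} &
      Wvar phi @ \oo --> 0%E].

(* Walters' condition makes every [Wvar phi n] finite, so that [fine] loses
   nothing in the presence of that condition. *)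
Definition Wreal phi (n : nat) : R := fine (Wvar phi n).

Definition admissible theta phi : Prop :=
  [/\ continuous phi, walters_condition phi &
   [\/ Wreal phi =O_\oo (fun n => theta ^+ n),
       (exists2 alpha : R, 1 < alpha &
          Wreal phi =O_\oo (fun n => n%:R `^ (- alpha))),
       (exists eta alpha : R, [/\ 0 < eta < 1, 1 < alpha &
          Wreal phi =O_\oo (fun n => eta `^ (ln n%:R `^ alpha))]) |
       (exists c alpha : R, [/\ 0 < c, 0 < alpha < 1 &
          Wreal phi =O_\oo (fun n => expR (- (c * n%:R `^ alpha)))])]].

Definition shift_invariant nu : Prop :=
  forall B : set (Omega A), measurable B -> nu (full_shift @^-1` B) = nu B.

(* Entropy of the join of xi, ..., T^-(n-1) xi, where a finite measurable
   partition is given by its labelling xi : Omega A -> 'I_k; labels that are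
   not taken, and null atoms, contribute 0 because [ln 0 = 0]. *)
Definition join_entropy nu (k : nat) (xi : Omega A -> 'I_k) (n : nat) : R :=
  \sum_(w : {ffun 'I_n -> 'I_k})
    let p := fine (nu [set x | forall i : 'I_n, xi (iter i full_shift x) = w i]) in
    - (p * ln p).

Definition partition_entropy nu (k : nat) (xi : Omega A -> 'I_k) : R :=
  limn (fun n => join_entropy nu xi n / n%:R).

(* Kolmogorov-Sinai entropy: the supremum is over all finite measurable
   partitions, not only the partition into one-letter cylinders. *)
Definition entropy nu : \bar R :=
  ereal_sup [set h : \bar R | exists (k : nat) (xi : Omega A -> 'I_k),
    (forall j, measurable (xi @^-1` [set j])) /\
    h = (partition_entropy nu xi)%:E].

Definition equilibrium_state phi mu : Prop :=
  shift_invariant mu /\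
  forall nu, shift_invariant nu ->
    (entropy nu + \int[nu]_x (phi x)%:E
       <= entropy mu + \int[mu]_x (phi x)%:E)%E.

Definition lipschitz_const theta (n : nat) (K : ('I_n -> Omega A) -> R)
    (i : 'I_n) (L : R) : Prop :=
  0 <= L /\
  forall x x' : 'I_n -> Omega A, (forall j, j != i -> x j = x' j) ->
    `|K x - K x'| <= L * dtheta theta (x i) (x' i).

Definition separately_lipschitz theta (n : nat) (K : ('I_n -> Omega A) -> R) :
    Prop :=
  forall i, exists L, lipschitz_const theta K i L.

Definition Lip theta (n : nat) (K : ('I_n -> Omega A) -> R) (i : 'I_n) : R :=
  inf [set L | lipschitz_const theta K i L].

Definition sum_Lip2 theta (n : nat) (K : ('I_n -> Omega A) -> R) : R :=
  \sum_(i < n) Lip theta K i ^+ 2.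

Definition orbit_seg (n : nat) x : 'I_n -> Omega A :=
  fun i => iter i full_shift x.

Definition gaussian_concentration theta mu C : Prop :=
  forall (n : nat) (K : ('I_n -> Omega A) -> R), (1 <= n)%N ->
    separately_lipschitz theta K ->
    (\int[mu]_x (expR (K (orbit_seg x)))%:E
       <= (expR (\int[mu]_x K (orbit_seg x))
             * expR (C * sum_Lip2 theta K))%:E)%E.

(* exp (- u^2 / (4 C S)), read as 0 when S = 0; the case split is needed
   because division by 0 would otherwise make it 1. *)
Definition gaussian_tail C (S u : R) : R :=
  if S == 0 then 0 else expR (- (u ^+ 2 / (4 * C * S))).

End FullShift.

(* Main.v *)
(* Scaling K by l > 0 scales sum_Lip2 K by l ^ 2, so the concentration bound for
   l K controls the moment generating function of the centred observable;
   Chernoff's inequality, optimised in l, gives the one-sided estimate, and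
   applying it to - K as well gives the two-sided one. Measurability and
   integrability of x |-> K (x, ..., T^(n-1) x) come from its continuity and
   boundedness: two points with the same first n + p letters have images at
   distance at most (sum_i Lip_i) theta ^ p. *)

Require Import Defs.
From mathcomp Require Import all_boot all_order all_algebra.
From mathcomp Require Import all_classical all_reals all_analysis measurable_realfun.
From mathcomp Require Import ring.

Set Implicit Arguments.
Unset Strict Implicit.
Unset Printing Implicit Defensive.

Import Order.TTheory GRing.Theory Num.Theory.
Import numFieldNormedType.Exports.

Local Open Scope classical_set_scope.
Local Open Scope ring_scope.

(** * Chernoff's inequality and the choice of the exponent *)

Section GaussianTail.
Context {R : realType}.

(* Optimising the exponent gives l = u / (2 C S); when S = 0, the bound
   exp (- l u) for all l > 0 leaves only the value 0. *)
Lemma le_gaussian_tail (p C S u : R) : 0 < C -> 0 <= S -> 0 < u ->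
  (forall l, 0 < l -> p <= expR (C * (l ^+ 2 * S) - l * u)) ->
  p <= gaussian_tail C S u.
Proof.
move=> C0 S0 u0 hp; rewrite /gaussian_tail; case: eqVneq => [S_eq0|S_neq0].
  rewrite leNgt; apply/negP => p0.
  (* With l = 1 / (p u) the hypothesis would read p <= exp (- 1 / p), whereas exp (1 / p) >= 1 + 1 /
     p > 1 / p. *)
  have pu0 : 0 < p^-1 / u by rewrite divr_gt0 ?invr_gt0.
  have := hp _ pu0; rewrite S_eq0 !mulr0 sub0r divfK ?gt_eqF//.
  rewrite expRN leNgt => /negP; apply.
  rewrite invf_plt ?posrE ?expR_gt0//.
  by apply: lt_le_trans (expR_ge1Dx _); rewrite ltrDr.
have S_gt0 : 0 < S by rewrite lt_def S_neq0.
have l0 : 0 < u / (2 * C * S) by rewrite divr_gt0 ?mulr_gt0.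
apply: (le_trans (hp _ l0)); rewrite ler_expR le_eqVlt; apply/orP; left.
by apply/eqP; field; rewrite !gt_eqF.
Qed.

Lemma measurable_superlevel d (T : measurableType d) (f : T -> R) (u : R) :
  measurable_fun setT f -> measurable [set x | u <= f x].
Proof.
move=> mf; rewrite -[X in measurable X]setTI.
exact: measurable_fun_le.
Qed.

(** Chernoff's inequality at level u + m costs a factor exp (- l (u + m)); the terms l m cancel,
    leaving the exponent that [le_gaussian_tail] optimises. *)
Lemma chernoff_gaussian_tail d (T : measurableType d) (P : probability T R)
    (F : T -> R) (m C S u : R) :
  measurable_fun setT F -> 0 < C -> 0 <= S -> 0 < u ->
  (forall l, 0 < l ->
    (\int[P]_x (expR (l * F x))%:E <= (expR (l * m + C * (l ^+ 2 * S)))%:E)%E) ->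
  (P [set x | (u <= F x - m)%R] <= (gaussian_tail C S u)%:E)%E.
Proof.
move=> mF C0 S0 u0 hF.
pose X : {RV P >-> R} := mfun_Sub (mem_set mF : F \in mfun).
have mlev : measurable [set x | u <= F x - m].
  exact/measurable_superlevel/measurable_funB.
rewrite -[leLHS]fineK ?fin_num_measure// lee_fin.
apply: le_gaussian_tail => // l l0.
rewrite -lee_fin fineK ?fin_num_measure//.
have -> : [set x | u <= F x - m] = [set x | u + m <= X x].
  by apply/seteqP; split => x /=; rewrite lerBrDr.
apply: (le_trans (chernoff X (u + m) l0)).
rewrite (_ : _ - _ = (l * m + C * (l ^+ 2 * S)) + (- (l * (u + m)))); last by ring.
rewrite expRD EFinM lee_wpmul2r ?lee_fin ?expR_ge0//.
rewrite /mmt_gen_fun unlock; apply: le_trans (hF _ l0).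
by under eq_integral do rewrite /= mulrC.
Qed.

End GaussianTail.

(** * Metric, topology and Borel sets of the full shift *)

Section FullShift.
Context {R : realType} {A : finPointedType}.
Implicit Types (x y : Omega A) (theta : R).

Lemma iter_full_shift i x k : iter i (@full_shift A) x k = x (i + k)%N.
Proof. by elim: i k => // i IH k; rewrite iterS /full_shift IH addnS. Qed.

Lemma dtheta_le theta p x y : 0 < theta < 1 ->
  (forall k, (k < p)%N -> x k = y k) -> dtheta theta x y <= theta ^+ p.
Proof.
move=> /andP[t0 t1] xy; rewrite /dtheta; case: pselect => [neq|_]; last first.
  by rewrite exprn_ge0 ?ltW.
case: ex_minnP => m xym _; rewrite ler_wiXn2l ?ltW//.
by rewrite leqNgt; apply: contra xym => /xy ->.
Qed.

Lemma dtheta_ge0 theta x y : 0 < theta < 1 -> 0 <= dtheta theta x y.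
Proof.
move=> /andP[t0 t1]; rewrite /dtheta.
by case: pselect => // ?; rewrite exprn_ge0 ?ltW.
Qed.

(** A cylinder is a finite intersection of preimages of singletons under coordinate projections, and
    singletons are open in the discrete alphabet. *)
Lemma near_cylinder x m : nbhs x [set y : Omega A | forall k, (k < m)%N -> y k = x k].
Proof.
have near_coord (k : 'I_m) : nbhs x [set y : Omega A | y k = x k].
  have := @proj_continuous nat (fun _ => discrete_topology A) k x.
  move=> /(_ [set x k]); apply; exact: (@discrete_set1 (discrete_topology A)).
have := @filter_forall _ _ _ (nbhs x) (nbhs_filter x) near_coord.
by apply: filterS => y xy k km; exact: (xy (Ordinal km)).
Qed.

Lemma continuous_measurable_Omega (F : Omega A -> R) :
  continuous F -> measurable_fun setT F.
Proof.
move=> /continuousP cF; apply: (measurability _ (RGenOpens.measurableE R)).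
move=> _ [_ [a [b ->] <-]]; rewrite setTI.
by apply: sub_sigma_algebra; exact/cF/interval_open.
Qed.

(** * Separately Lipschitz observables along an orbit *)

Section SeparatelyLipschitz.
Variables (theta : R) (n : nat) (K : ('I_n -> Omega A) -> R).
Hypothesis ht : 0 < theta < 1.
Hypothesis hK : separately_lipschitz theta K.

Lemma Lip_ge0 i : 0 <= Lip theta K i.
Proof. by apply: lb_le_inf; [exact: hK|move=> L []]. Qed.

Lemma sum_Lip2_ge0 : 0 <= sum_Lip2 theta K.
Proof. by apply: sumr_ge0 => i _; exact: sqr_ge0. Qed.

(** The infimum is attained: at positive distance the difference quotient is a lower bound of all
    constants, and at distance 0 any one constant forces the difference of values to vanish. *)
Lemma lipschitz_const_Lip i : lipschitz_const theta K i (Lip theta K i).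
Proof.
split=> [|x x' xx']; first exact: Lip_ge0.
have [d0|d0] := eqVneq (dtheta theta (x i) (x' i)) 0.
  have [L [_ /(_ _ _ xx')]] := hK i.
  by rewrite d0 !mulr0.
have dgt0 : 0 < dtheta theta (x i) (x' i) by rewrite lt_def d0 dtheta_ge0.
rewrite -ler_pdivrMr//; apply: lb_le_inf; first exact: hK.
by move=> L [_ hL]; rewrite ler_pdivrMr// hL.
Qed.

(* Telescoping through the points that agree with y up to coordinate k and
   with x from there on. *)
Lemma separately_lipschitz_dist (x y : 'I_n -> Omega A) :
  `|K x - K y| <= \sum_(i < n) Lip theta K i * dtheta theta (x i) (y i).
Proof.
pose z k : 'I_n -> Omega A := fun j => if (j < k)%N then y j else x j.
have -> : K x = K (z 0%N) by [].
have -> : K y = K (z n).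
  by congr K; apply: funext => j; rewrite /z ltn_ord.
rewrite distrC -(telescope_sumr (fun k => K (z k)) (leq0n n)) big_mkord.
apply: (le_trans (ler_norm_sum _ _ _)); apply: ler_sum => i _.
rewrite distrC.
have [_ /(_ (z i) (z i.+1))] := lipschitz_const_Lip i.
have -> : z i i = x i by rewrite /z ltnn.
have -> : z i.+1 i = y i by rewrite /z ltnSn.
apply => j ji.
have /negbTE ji' : (j : nat) != i by [].
by rewrite /z ltnS (leq_eqVlt j) ji'.
Qed.

(** The i-th orbit point loses the first i < n letters, so at least p common letters remain at every
    coordinate. *)
Lemma orbit_seg_dist p x y : (forall k, (k < n + p)%N -> x k = y k) ->
  `|K (orbit_seg x) - K (orbit_seg y)| <=
  (\sum_(i < n) Lip theta K i) * theta ^+ p.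
Proof.
move=> xy; apply: (le_trans (separately_lipschitz_dist _ _)).
rewrite mulr_suml; apply: ler_sum => i _; rewrite ler_wpM2l ?Lip_ge0//.
apply: dtheta_le => // k kp; rewrite /orbit_seg !iter_full_shift xy//.
by rewrite -addSn leq_add ?(ltnW kp).
Qed.

Lemma orbit_seg_continuous : continuous (fun x => K (orbit_seg x)).
Proof.
move=> x.
apply/(@cvgrPdist_le R R (Omega A) (nbhs x) (nbhs_filter x)) => e e0.
have : (fun p => (\sum_(i < n) Lip theta K i) * theta ^+ p) @ \oo --> (0 : R).
  rewrite -[X in _ --> X](mulr0 (\sum_(i < n) Lip theta K i)).
  apply: cvgM; first exact: cvg_cst.
  by apply: cvg_expr; case/andP: ht => t0 t1; rewrite ger0_norm ?ltW.
move=> /cvgrPdist_le /(_ _ e0) [p _ /(_ p (leqnn p))].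
rewrite sub0r normrN => /(le_trans (ler_norm _)) pe.
apply: filterS (near_cylinder x (n + p)) => y xy.
by apply: le_trans (orbit_seg_dist _) pe => k kp; rewrite xy.
Qed.

Lemma orbit_seg_measurable : measurable_fun setT (fun x => K (orbit_seg x)).
Proof. exact: continuous_measurable_Omega orbit_seg_continuous. Qed.

Lemma orbit_seg_integrable (mu : probability (Omega A) R) :
  mu.-integrable setT (EFin \o (fun x => K (orbit_seg x))).
Proof.
apply: measurable_bounded_integrable => //.
- by rewrite (le_lt_trans (probability_le1 mu _)) ?ltry.
- exact: orbit_seg_measurable.
pose x0 : Omega A := point.
apply/ex_bound; first exact: (@globally_properfilter _ _ x0).
exists (`|K (orbit_seg x0)| + \sum_(i < n) Lip theta K i) => x _.
rewrite /= -lerBlDl; apply: (le_trans (lerB_dist _ _)).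
apply: (le_trans (separately_lipschitz_dist _ _)); apply: ler_sum => i _.
(* The case p = 0 of [dtheta_le]: all distances are at most 1. *)
by rewrite ler_piMr ?Lip_ge0// (@dtheta_le _ 0).
Qed.

Lemma lipschitz_constZ c i L : lipschitz_const theta K i L ->
  lipschitz_const theta (fun z => c * K z) i (`|c| * L).
Proof.
move=> [L0 hL]; split=> [|x x' xx']; first by rewrite mulr_ge0.
by rewrite -mulrBr normrM -mulrA ler_wpM2l// hL.
Qed.

Lemma separately_lipschitzZ c : separately_lipschitz theta (fun z => c * K z).
Proof.
by move=> i; have [L] := hK i; exists (`|c| * L); exact: lipschitz_constZ.
Qed.

(** [|c| * Lip theta K i] is one of the constants over which the infimum for c K is taken. *)
Lemma sum_Lip2Z c :
  sum_Lip2 theta (fun z => c * K z) <= c ^+ 2 * sum_Lip2 theta K.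
Proof.
rewrite mulr_sumr; apply: ler_sum => i _.
rewrite -(real_normK (num_real c)) -exprMn.
rewrite ler_pXn2r// ?nnegrE ?mulr_ge0 ?Lip_ge0//; last first.
  by apply: lb_le_inf; [exact: separately_lipschitzZ|move=> L []].
apply: ge_inf; first by exists 0 => L [].
exact/lipschitz_constZ/lipschitz_const_Lip.
Qed.

End SeparatelyLipschitz.

(** Allowing any upper bound [S] of [sum_Lip2 theta K] lets - K be treated with the same tail as K,
    without comparing values of [gaussian_tail]. *)
Lemma gaussian_upper_tail theta (mu : probability (Omega A) R) (C : R)
    (n : nat) (K : ('I_n -> Omega A) -> R) (S u : R) :
  0 < theta < 1 -> 0 < C -> gaussian_concentration theta mu C -> (1 <= n)%N ->
  separately_lipschitz theta K -> sum_Lip2 theta K <= S -> 0 < u ->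
  (mu [set x | (u <= K (orbit_seg x) - \int[mu]_y K (orbit_seg y))%R]
     <= (gaussian_tail C S u)%:E)%E.
Proof.
move=> ht C0 hG hn hK hS u0.
apply: chernoff_gaussian_tail => //; first exact: (orbit_seg_measurable ht).
  exact: le_trans (sum_Lip2_ge0 theta K) hS.
move=> l l0.
apply: (le_trans (hG n (fun z => l * K z) hn (separately_lipschitzZ hK l))).
rewrite -expRD lee_fin ler_expR RintegralZl//; last exact: (orbit_seg_integrable ht).
rewrite lerD2l ler_pM2l// (le_trans (sum_Lip2Z ht hK l))//.
by rewrite ler_wpM2l// sqr_ge0.
Qed.

End FullShift.

Theorem corollary3p3 (R : realType) (A : finPointedType) (theta : R)
    (htheta : 0 < theta < 1)
    (phi : Omega A -> R) (hphi : admissible theta phi)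
    (mu : probability (Omega A) R) (hmu : equilibrium_state phi mu)
    (C : R) (hC : 0 < C) (hGCB : gaussian_concentration theta mu C)
    (n : nat) (hn : (1 <= n)%N)
    (K : ('I_n -> Omega A) -> R) (hK : separately_lipschitz theta K)
    (u : R) (hu : 0 < u) :
  (mu [set x | (u <= K (orbit_seg x)
                     - \int[mu]_y K (orbit_seg y))%R]
     <= (gaussian_tail C (sum_Lip2 theta K) u)%:E)%E
  /\
  (mu [set x | (u <= `|K (orbit_seg x)
                       - \int[mu]_y K (orbit_seg y)|)%R]
     <= (2 * gaussian_tail C (sum_Lip2 theta K) u)%:E)%E.
Proof.
have upper := gaussian_upper_tail htheta hC hGCB hn hK (lexx _) hu.
split=> //.
(* Written as a multiple by -1 so that the scaling lemmas apply with c = -1. *)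
pose N := fun x => -1 * K x.
have hN : separately_lipschitz theta N := separately_lipschitzZ hK (-1).
have SN : sum_Lip2 theta N <= sum_Lip2 theta K.
  by have := sum_Lip2Z htheta hK (-1); rewrite sqrrN expr1n mul1r.
have lower := gaussian_upper_tail htheta hC hGCB hn hN SN hu.
have mK := orbit_seg_measurable htheta hK.
rewrite mulr_natl mulr2n EFinD; apply: le_trans (leeD upper lower).
have mup : measurable [set x | u <= K (orbit_seg x) - \int[mu]_y K (orbit_seg y)].
  exact/measurable_superlevel/measurable_funB.
have mlow : measurable [set x | u <= N (orbit_seg x) - \int[mu]_y N (orbit_seg y)].
  by apply/measurable_superlevel/measurable_funB => //; exact: orbit_seg_measurable htheta hN.
(* Union bound: a deviation of size u is an upper deviation of K or of [N]. *)
apply: le_trans (measureU2 _ mup mlow).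
apply: le_measure; rewrite ?inE//.
- apply: measurable_superlevel.
  by apply: measurableT_comp => //; exact: measurable_funB.
- exact: measurableU.
move=> x /=; rewrite ler_normr => /orP[|]; [by left|right].
rewrite /N RintegralZl//; last exact: (orbit_seg_integrable htheta).
by rewrite !mulN1r -opprD.
Qed.
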